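(* Let IPC be presented as the Hilbert-style logic over the language $\{\land,\lor,\longrightarrow,\neg,0,1\}$ with axiom schemes (A1)–(A10) below and the single rule modus ponens $\frac{\alpha,\ \alpha\longrightarrow\beta}{\beta}$. Then the left variable inclusion companion of IPC coincides with its restricted rules companion, i.e. the Hilbert-style logic with axioms (A1)–(A10) and the single rule $\frac{\alpha,\ \alpha\longrightarrow\beta}{\beta}$ provided $\mathrm{var}(\alpha)\subseteq\mathrm{var}(\beta)$ has the same consequence relation as $\vdash_{\mathrm{IPC}}^l$. The axioms are: (A1) $\alpha\longrightarrow(\beta\longrightarrow\alpha)$; (A2) $(\alpha\longrightarrow(\beta\longrightarrow\gamma))\longrightarrow((\alpha\longrightarrow\beta)\longrightarrow(\alpha\longrightarrow\gamma))$; (A3) $\alpha\longrightarrow(\beta\longrightarrow(\alpha\land\beta))$; (A4) $\alpha\land\beta\longrightarrow\alpha$; (A5) $\alpha\land\beta\longrightarrow\beta$; (A6) $\alpha\longrightarrow\alpha\lor\beta$; (A7) $\beta\longrightarrow\alpha\lor\beta$; (A8) $(\alpha\longrightarrow\gamma)\longrightarrow((\beta\longrightarrow\gamma)\longrightarrow(\alpha\lor\beta\longrightarrow\gamma))$; (A9) $(\alpha\longrightarrow\beta)\longrightarrow((\alpha\longrightarrow\neg\beta)\longrightarrow\neg\alpha)$; (A10) $0\longrightarrow\alpha$.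
   Context: Formulas are built over a countably infinite set $V$ of variables with connectives $\land,\lor,\longrightarrow$ (binary), $\neg$ (unary), $0,1$ (constants); $\mathit{Fm}$ is the set of formulas. In a Hilbert-style logic, $\Sigma\vdash\varphi$ iff there is a finite sequence ending in $\varphi$ each member of which is an instance of an axiom, a member of $\Sigma$, or obtained from earlier members by a rule. $\mathrm{var}(\varphi)$ is the set of variables of $\varphi$, $\mathrm{var}(\Gamma)=\bigcup_{\gamma\in\Gamma}\mathrm{var}(\gamma)$. The left variable inclusion companion $\vdash^l_{\mathrm{IPC}}$: $\Gamma\vdash^l_{\mathrm{IPC}}\varphi$ iff there is $\Gamma'\subseteq\Gamma$ with $\mathrm{var}(\Gamma')\subseteq\mathrm{var}(\varphi)$ and $\Gamma'\vdash_{\mathrm{IPC}}\varphi$. The restricted rules companion keeps the axioms and restricts each rule $\frac{\Gamma}{\alpha}$ to instances with $\mathrm{var}(\Gamma)\subseteq\mathrm{var}(\alpha)$. *)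

(* Defs.v *)
From mathcomp Require Import all_boot.
From mathcomp Require Import classical_sets.

Set Implicit Arguments.
Unset Strict Implicit.
Unset Printing Implicit Defensive.

Local Open Scope classical_set_scope.

Inductive formula (V : Type) : Type :=
| Var of V
| And of formula V & formula V
| Or of formula V & formula V
| Imp of formula V & formula V
| Neg of formula V
| Zero
| One.
Arguments Zero {V}.
Arguments One {V}.

Declare Scope formula_scope.
Delimit Scope formula_scope with F.
Bind Scope formula_scope with formula.
Notation "a ⟶ b" := (Imp a b) (at level 60, right associativity) : formula_scope.
Notation "a ⊓ b" := (And a b) (at level 50, left associativity) : formula_scope.
Notation "a ⊔ b" := (Or a b) (at level 50, left associativity) : formula_scope.

Fixpoint var (V : Type) (a : formula V) : set V :=
  match a with
  | Var x => [set x]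
  | And b c | Or b c | Imp b c => var b `|` var c
  | Neg b => var b
  | Zero | One => set0
  end.

Definition vars (V : Type) (G : set (formula V)) : set V :=
  \bigcup_(g in G) var g.

(* [axiom] and [rule] are the sets of all instances of the axiom schemes and
   of the rule schemes; [rule P a] is the instance with premises [P] and
   conclusion [a]. *)
Record hilbert (V : Type) : Type := Hilbert {
  axiom : set (formula V);
  rule : set (formula V) -> set (formula V)
}.

(* The derivation is the nonempty finite sequence d 0, ..., d n. *)
Definition derives (V : Type) (H : hilbert V)
    (S : set (formula V)) (a : formula V) : Prop :=
  exists (n : nat) (d : 'I_n.+1 -> formula V),
    d ord_max = a /\
    forall i : 'I_n.+1,
      [\/ axiom H (d i),
          S (d i) |
          exists P : set (formula V),
            rule H P (d i) /\ P `<=` d @` [set j : 'I_n.+1 | (j < i)%N]].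

Definition left_companion (V : Type)
    (L : set (formula V) -> formula V -> Prop)
    (G : set (formula V)) (a : formula V) : Prop :=
  exists G' : set (formula V),
    [/\ G' `<=` G, vars G' `<=` var a & L G' a].

Definition restricted_rules (V : Type) (H : hilbert V) : hilbert V :=
  Hilbert (axiom H) (fun P a => rule H P a /\ vars P `<=` var a).

Inductive IPC_axiom (V : Type) : formula V -> Prop :=
| A1 a b : IPC_axiom (a ⟶ (b ⟶ a))
| A2 a b c : IPC_axiom ((a ⟶ (b ⟶ c)) ⟶ ((a ⟶ b) ⟶ (a ⟶ c)))
| A3 a b : IPC_axiom (a ⟶ (b ⟶ (a ⊓ b)))
| A4 a b : IPC_axiom ((a ⊓ b) ⟶ a)
| A5 a b : IPC_axiom ((a ⊓ b) ⟶ b)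
| A6 a b : IPC_axiom (a ⟶ (a ⊔ b))
| A7 a b : IPC_axiom (b ⟶ (a ⊔ b))
| A8 a b c : IPC_axiom ((a ⟶ c) ⟶ ((b ⟶ c) ⟶ ((a ⊔ b) ⟶ c)))
| A9 a b : IPC_axiom ((a ⟶ b) ⟶ ((a ⟶ Neg b) ⟶ Neg a))
| A10 a : IPC_axiom (Zero ⟶ a).

Inductive modus_ponens (V : Type) : set (formula V) -> formula V -> Prop :=
| MP a b : modus_ponens [set a; a ⟶ b]%F b.

Inductive restricted_modus_ponens (V : Type) :
    set (formula V) -> formula V -> Prop :=
| RMP a b : var a `<=` var b -> restricted_modus_ponens [set a; a ⟶ b]%F b.

Definition IPC (V : Type) : hilbert V :=
  Hilbert (@IPC_axiom V) (@modus_ponens V).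

Definition IPC_restricted_MP (V : Type) : hilbert V :=
  Hilbert (@IPC_axiom V) (@restricted_modus_ponens V).

(* Main.v *)
Require Import Defs.
From mathcomp Require Import all_boot.
From mathcomp Require Import boolp.
From mathcomp Require Import classical_sets cardinality.

Local Open Scope classical_set_scope.

(** Suppose Γ' ⊢ φ in IPC with var(Γ') ⊆ var(φ). Let σ send every variable
outside var(φ) to 0, so that σ fixes φ and Γ', and let T be the theorem φ → φ.
By induction on derivations, T → σ(ψ) has a restricted derivation whenever
Γ' ⊢ ψ: modus ponens is simulated through (A2), and since var(T) = var(φ)
contains all variables in sight, each detachment meets the side condition.
Finally T has a restricted derivation, and detaching it from T → φ is
allowed because var(T) = var(φ). *)

Lemma derives_mono {V : Type} {H K : hilbert V} {S S' : set (formula V)} {a} :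
    Defs.axiom H `<=` Defs.axiom K -> (forall P, rule H P `<=` rule K P) ->
    S `<=` S' ->
  derives H S a -> derives K S' a.
Proof.
move=> HKa HKr SS' [n [d [da dP]]]; exists n, d; split=> // i.
case: (dP i) => [/HKa|/SS'|[P [rP Pd]]]; [exact: Or31|exact: Or32|].
by apply: Or33; exists P; split=> //; apply: HKr.
Qed.

(** Strong induction on the position in the sequence: a rule only draws its premises from earlier
    positions. Later proofs can thus ignore the sequence itself. *)
Lemma derives_ind {V : Type} {H : hilbert V} {S : set (formula V)}
    (Q : formula V -> Prop) :
    Defs.axiom H `<=` Q -> S `<=` Q ->
    (forall P b, rule H P b -> P `<=` Q -> Q b) ->
  forall a, derives H S a -> Q a.
Proof.
move=> Qax QS Qrule a [n [d [<- dP]]].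
suff Qd k (i : 'I_n.+1) : (i < k)%N -> Q (d i) by exact: (Qd n.+1).
elim: k i => [//|k IHk] i le_ik.
case: (dP i) => [/Qax //|/QS //|[P [rP Pd]]].
apply: (Qrule P) => // _ /Pd[j /= ji <-].
by apply: IHk; exact: leq_trans ji le_ik.
Qed.

Lemma derives_axiom {V : Type} {H : hilbert V} {S : set (formula V)} {a} :
  Defs.axiom H a -> derives H S a.
Proof. by move=> Ha; exists 0, (fun=> a); split=> // i; apply: Or31. Qed.

Lemma derives_hyp {V : Type} {H : hilbert V} {S : set (formula V)} {a} :
  S a -> derives H S a.
Proof. by move=> Sa; exists 0, (fun=> a); split=> // i; apply: Or32. Qed.

(** Indexing by natural numbers, with arbitrary values beyond [n], lets sequences be concatenated by
    plain arithmetic on positions. *)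
Lemma derivesP {V : Type} (H : hilbert V) (S : set (formula V)) a :
  derives H S a <-> exists n (f : nat -> formula V), f n = a /\
    forall i, (i <= n)%N -> [\/ Defs.axiom H (f i), S (f i) |
      exists P, rule H P (f i) /\ P `<=` f @` [set j | (j < i)%N]].
Proof.
split=> [[n [d [da dP]]]|[n [f [fa fP]]]].
  exists n, (fun k => d (inord k)); split.
    by rewrite -da; congr d; apply: val_inj; rewrite /= inordK.
  move=> i le_in; case: (dP (inord i)) => [?|?|[P [rP Pd]]];
    [exact: Or31|exact: Or32|apply: Or33].
  exists P; split=> // _ /Pd[j /= ji <-]; exists j; last by rewrite inord_val.
  by move: ji; rewrite inordK.
exists n, (fun i => f i); split=> // i.
case: (fP i (leq_ord i)) => [?|?|[P [rP Pd]]];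
  [exact: Or31|exact: Or32|apply: Or33].
exists P; split=> // _ /Pd[j /= ji <-].
by exists (Ordinal (ltn_trans ji (ltn_ord i))).
Qed.

Lemma derives_rule2 {V : Type} {H : hilbert V} {S : set (formula V)} {a b c} :
    rule H [set a; b] c ->
  derives H S a -> derives H S b -> derives H S c.
Proof.
move=> rc /derivesP[n [f [fa fP]]] /derivesP[m [g [gb gP]]].
(* Concatenation: [f] fills positions 0 to [n], [g] the next [m.+1] positions, and [c] comes last,
   at [n.+1 + m.+1]. *)
pose h k := if (k <= n)%N then f k
  else if (k - n.+1 <= m)%N then g (k - n.+1)%N else c.
have hf k : (k <= n)%N -> h k = f k by rewrite /h => ->.
have hg k : (k <= m)%N -> h (n.+1 + k)%N = g k.
  by move=> km; rewrite /h leqNgt leq_addr /= addKn km.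
have hc : h (n.+1 + m.+1)%N = c by rewrite /h leqNgt leq_addr /= addKn ltnn.
apply/derivesP; exists (n.+1 + m.+1)%N, h; split=> // i.
have [le_in _|lt_ni] := leqP i n.
  rewrite hf //; case: (fP i le_in) => [?|?|[P [rP Pf]]];
    [exact: Or31|exact: Or32|apply: Or33].
  exists P; split=> // _ /Pf[j /= ji <-]; exists j => //.
  by rewrite hf // (leq_trans (ltnW ji)).
rewrite -(subnKC lt_ni); set k := (i - n.+1)%N.
rewrite leq_add2l leq_eqVlt => /orP[/eqP ->|].
  rewrite hc; apply: Or33; exists [set a; b]; split=> // _ [->|->].
    by exists n; [rewrite /= addSn ltnS leq_addr|rewrite hf].
  by exists (n.+1 + m)%N; [rewrite /= ltn_add2l|rewrite hg].
rewrite ltnS => le_km; rewrite hg //.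
case: (gP k le_km) => [?|?|[P [rP Pg]]];
  [exact: Or31|exact: Or32|apply: Or33].
exists P; split=> // _ /Pg[j /= jk <-]; exists (n.+1 + j)%N.
  by rewrite /= ltn_add2l.
by rewrite hg // (leq_trans (ltnW jk)).
Qed.

Fixpoint subst {V : Type} (s : V -> formula V) (a : formula V) : formula V :=
  match a with
  | Var x => s x
  | And b c => And (subst s b) (subst s c)
  | Or b c => Or (subst s b) (subst s c)
  | Imp b c => Imp (subst s b) (subst s c)
  | Neg b => Neg (subst s b)
  | Zero => Zero
  | One => One
  end.

Lemma subst_id {V : Type} (s : V -> formula V) a :
  (forall x, var a x -> s x = Var x) -> subst s a = a.
Proof.
elim: a => //= [x|b IHb c IHc|b IHb c IHc|b IHb c IHc|b IHb] sE;
  first exact: sE.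
- by rewrite IHb ?IHc // => x ?; apply: sE; [right|left].
- by rewrite IHb ?IHc // => x ?; apply: sE; [right|left].
- by rewrite IHb ?IHc // => x ?; apply: sE; [right|left].
- by rewrite IHb.
Qed.

Lemma var_subst_sub {V : Type} (s : V -> formula V) (X : set V) a :
  (forall x, var (s x) `<=` X) -> var (subst s a) `<=` X.
Proof.
move=> sX; elim: a => //= b IHb c IHc;
  by rewrite subUset.
Qed.

Lemma IPC_axiom_subst {V : Type} (s : V -> formula V) a :
  IPC_axiom a -> IPC_axiom (subst s a).
Proof. by case=> *; constructor. Qed.

Lemma derives_RMP {V : Type} {S : set (formula V)} {a b} :
    var a `<=` var b ->
    derives (IPC_restricted_MP V) S a ->
    derives (IPC_restricted_MP V) S (Imp a b) ->
  derives (IPC_restricted_MP V) S b.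
Proof. by move=> ab; apply: derives_rule2; exact: RMP. Qed.

(** The usual derivation from (A1) and (A2) survives the restriction, since every formula in it has
    exactly the variables of [a]. *)
Lemma derives_restricted_id {V : Type} (S : set (formula V)) a :
  derives (IPC_restricted_MP V) S (Imp a a).
Proof.
have A1r b c : derives (IPC_restricted_MP V) S (Imp b (Imp c b)).
  by apply: derives_axiom; exact: A1.
apply: (derives_RMP _ (A1r a a)); first by rewrite /= !setUid.
apply: (derives_RMP _ (A1r a (Imp a a))); first by rewrite /= !setUid.
by apply: derives_axiom; exact: A2.
Qed.

Lemma left_companion_restricted_MP {V : Type} (G : set (formula V)) a :
  left_companion (derives (IPC V)) G a -> derives (IPC_restricted_MP V) G a.
Proof.
case=> G' [G'G varG' G'a].
pose s x := if `[< var a x >] then Var x else Zero.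
have sE x : var a x -> s x = Var x by rewrite /s => /asboolT ->.
have s_sub b : var (subst s b) `<=` var a.
  apply: var_subst_sub => x; rewrite /s.
  by case: asboolP => /= [ax _ ->|_ _ []].
pose T := Imp a a.
have varT : var T = var a by rewrite /= setUid.
have padded b : derives (IPC_restricted_MP V) G (subst s b) ->
    derives (IPC_restricted_MP V) G (Imp T (subst s b)).
  move=> Gb; apply: (derives_RMP _ Gb); first exact: subsetUr.
  by apply: derives_axiom; exact: A1.
have GT : derives (IPC_restricted_MP V) G (Imp T (subst s a)).
  apply: (derives_ind (fun b => derives _ G (Imp T (subst s b)))) _ G'a
    => [b|b G'b|P b [{}b c] GP].
  - move=> /(IPC_axiom_subst s) sb; apply: padded; exact: derives_axiom.
  - apply: padded; rewrite subst_id => [|x bx].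
      by apply: derives_hyp; exact: G'G.
    by apply/sE/varG'; exists b.
  - have Gb := GP b (or_introl erefl).
    have Gbc := GP (Imp b c) (or_intror erefl).
    (* Substituted formulas only use variables of [a], all of which occur in [T]; this yields both
       side conditions below. *)
    have sub_T d e : var (Imp T (subst s d)) `<=` var (Imp T e).
      rewrite [X in X `<=` _]/= subUset -/(var T) setUid; split.
        by rewrite -varT; exact: subsetUl.
      by apply: subset_trans (s_sub d) _; rewrite -varT; exact: subsetUl.
    (* Two detachments from the instance of (A2) that distributes [T] over the substituted
       implication. *)
    apply: (derives_RMP (sub_T b _) Gb).
    apply: derives_RMP Gbc _.
      by apply: subset_trans (sub_T _ (subst s c)) _; exact: subsetUr.
    by apply: derives_axiom; exact: A2.
rewrite subst_id in GT; last exact: sE.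
by apply: derives_RMP (derives_restricted_id G a) GT; rewrite varT.
Qed.

(** Bounding the variables of the minor premise by those of the conclusion also bounds those of the
    major premise. *)
Lemma restricted_MP_restricted_rules {V : Type} (G : set (formula V)) a :
  derives (IPC_restricted_MP V) G a -> derives (restricted_rules (IPC V)) G a.
Proof.
apply: derives_mono => // P b [{}b c] bc; split; first exact: MP.
by move=> x [_ [->|->]] /=; [exact: bc|case=> // /bc].
Qed.

Lemma restricted_rules_left_companion {V : Type} (G : set (formula V)) a :
    derives (restricted_rules (IPC V)) G a ->
  left_companion (derives (IPC V)) G a.
Proof.
(* [Gv a] is the largest possible witness for the companion. *)
pose Gv b := [set g | G g /\ var g `<=` var b].
move=> Ga; exists (Gv a); split=> [g []//|x [g [_]]|]; first exact.
(* The hypothesis set varies with the formula: a premise [c] of a restricted rule with conclusion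
   [b] has its variables in [b], so [Gv c] lies in [Gv b] and monotonicity applies. *)
apply: (derives_ind (fun b => derives (IPC V) (Gv b) b)) _ Ga
  => [b|b Gb|P b [rP Pb] GP].
- by move=> Ab; apply: derives_axiom.
- by apply: derives_hyp; split.
have {}GP c : P c -> derives (IPC V) (Gv b) c.
  move=> Pc; apply: derives_mono (GP c Pc) => [//|Q //|g [Gg gc]].
  by split=> // x /gc cx; apply: Pb; exists c.
case: rP GP {Pb} => b1 c GP.
by apply: (derives_rule2 (H := IPC V) (MP b1 c)); apply: GP; [left|right].
Qed.

Theorem theorem4p5 (V : Type) (hV : ([set: V] #= [set: nat])%card)
    (G : set (formula V)) (a : formula V) :
  (left_companion (derives (IPC V)) G a
     <-> derives (restricted_rules (IPC V)) G a) /\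
  (left_companion (derives (IPC V)) G a
     <-> derives (IPC_restricted_MP V) G a).
Proof.
(* The three relations are linked by a cycle of implications; the directions not proved directly are
   compositions along it. *)
split; split.
- by move/left_companion_restricted_MP/restricted_MP_restricted_rules.
- exact: restricted_rules_left_companion.
- exact: left_companion_restricted_MP.
- by move/restricted_MP_restricted_rules/restricted_rules_left_companion.
Qed.
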